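(* Circles are the only convex discs in the Euclidean plane whose caps are all isosceles. That is, for a convex disc $C$ in the Euclidean plane, all caps of $C$ are isosceles if and only if $C$ is a circular disc.
   Context: A convex disc is a compact convex subset of the Euclidean plane with nonempty interior. Let $C$ be a convex disc and $S$ a point outside $C$. Suppose that the two tangent (supporting) lines of $C$ through $S$ touch $C$ at points $P$ and $Q$ respectively, where $P$ (resp. $Q$) may be any point of contact if the line touches $C$ in more than one point. The cap $\widehat{PSQ}$ is the union of the segments $PS$ and $SQ$. The cap $\widehat{PSQ}$ is called isosceles if the segments $PS$ and $SQ$ have equal lengths. *)

(* Defs.v *)
From HB Require Import structures.
From mathcomp Require Import all_boot all_order all_algebra.
From mathcomp Require Import all_classical all_reals all_analysis.

Set Implicit Arguments.
Unset Strict Implicit.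
Unset Printing Implicit Defensive.

Import Order.TTheory GRing.Theory Num.Theory.
Import numFieldNormedType.Exports.

Local Open Scope classical_set_scope.
Local Open Scope ring_scope.

(* The library norm on row vectors is the sup norm, so the Euclidean inner
   product and distance are defined here.  Both norms induce the same topology,
   so [compact] and [interior] have their usual meaning on the plane. *)
Notation plane R := 'rV[R]_2.

Section Plane.
Context {R : realType}.
Implicit Types (x y u : plane R) (C L : set (plane R)).

Definition dot x y : R := \sum_(i < 2) x 0 i * y 0 i.

Definition edist x y : R := Num.sqrt (dot (x - y) (x - y)).

Definition segment x y : set (plane R) :=
  [set (1 - t) *: x + t *: y | t in `[0, 1]].

Definition convex_disc C : Prop :=
  [/\ compact C, convex_set C & interior C !=set0].

Definition circular_disc C : Prop :=
  exists c (r : R), 0 < r /\ C = [set x | edist x c <= r].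

(* The sign of the normal vector u is free, so C may lie on either side of L. *)
Definition supporting_line C L : Prop :=
  exists u (a : R),
    [/\ u != 0, L = [set x | dot u x = a],
        C `<=` [set x | dot u x <= a] & C `&` L !=set0].

(* A convex disc has exactly two supporting lines through an outer point, so
   "the two tangent lines" are any two distinct ones.  The contact points P and
   Q are arbitrary points of C on these lines. *)
Record cap C := Cap {
  cap_S : plane R;
  cap_P : plane R;
  cap_Q : plane R;
  cap_outside : ~ C cap_S;
  cap_tangents : exists L M : set (plane R),
    [/\ supporting_line C L, supporting_line C M, L <> M,
        (L `&` M) cap_S & (C `&` L) cap_P /\ (C `&` M) cap_Q] }.

Definition cap_set C (K : cap C) : set (plane R) :=
  segment (cap_P K) (cap_S K) `|` segment (cap_S K) (cap_Q K).

(* The length of a segment is the distance between its endpoints. *)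
Definition isosceles C (K : cap C) : Prop :=
  edist (cap_P K) (cap_S K) = edist (cap_S K) (cap_Q K).

End Plane.

(* Main.v *)
Require Import Defs.
From HB Require Import structures.
From mathcomp Require Import all_boot all_order all_algebra.
From mathcomp Require Import all_classical all_reals all_analysis.
From mathcomp Require Import ring lra.

Import Order.TTheory GRing.Theory Num.Theory.
Import numFieldNormedType.Exports.

Local Open Scope classical_set_scope.
Local Open Scope ring_scope.

(** Let [P_u] be a point of C maximizing [dot u], for u a unit vector.  If all
    caps are isosceles, then [P_u] is unique, and mirror symmetry of a cap in
    the bisector at its apex gives (P_u - P_v) . (u + v) = 0 for all unit u, v.
    Taking v to be plus or minus a coordinate vector shows that
    [P_u = c + M u] for a fixed matrix M.  Putting this back into the equation
    forces M = r I.  So C contains the circle of centre c and radius r, hence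
    its disc, and the supporting lines show that C contains nothing else. *)

Section Plane.
Context {R : realType}.
Implicit Types (x y u v w P Q S : plane R) (C : set (plane R)) (a b t r : R).

(** * Coordinates, quarter turns and distances *)

Definition point a b : plane R := \row_i (if i == 0 then a else b).

(** The counterclockwise quarter turn; [dot (perp u) v] is the determinant of [u] and [v], zero
    exactly when they are parallel. *)
Definition perp u := point (- u 0 1) (u 0 0).

(** For nonzero [u], [P] is a point where the supporting line with outer normal [u] touches [C]. *)
Definition contact C u P := C P /\ forall x, C x -> dot u x <= dot u P.

Lemma point0 a b : point a b 0 0 = a.
Proof. by rewrite mxE. Qed.

Lemma point1 a b : point a b 0 1 = b.
Proof. by rewrite mxE. Qed.

Lemma perp0 u : perp u 0 0 = - u 0 1.
Proof. exact: point0. Qed.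

Lemma perp1 u : perp u 0 1 = u 0 0.
Proof. exact: point1. Qed.

Lemma dotE x y : dot x y = x 0 0 * y 0 0 + x 0 1 * y 0 1.
Proof.
rewrite /dot !big_ord_recl big_ord0 addr0 (_ : lift ord0 ord0 = 1)//.
exact/val_inj.
Qed.

Lemma plane_eq x y : x 0 0 = y 0 0 -> x 0 1 = y 0 1 -> x = y.
Proof.
move=> e0 e1; apply/rowP => -[[|[|//]] i].
- by rewrite (_ : Ordinal i = 0)//; exact/val_inj.
- by rewrite (_ : Ordinal i = 1)//; exact/val_inj.
Qed.

Definition planeE := (dotE, perp0, perp1, point0, point1, mxE).

Lemma dot_ge0 x : 0 <= dot x x.
Proof. by rewrite dotE; nra. Qed.

Lemma dot_gt0 x : x != 0 -> 0 < dot x x.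
Proof.
move=> x0; rewrite lt_neqAle dot_ge0 andbT eq_sym; apply: contra x0 => /eqP.
by rewrite dotE => e; apply/eqP/plane_eq; rewrite mxE; nra.
Qed.

Lemma unit_neq0 u : dot u u = 1 -> u != 0.
Proof.
move=> uu; apply/eqP => u0; move: uu.
by rewrite u0 !planeE mul0r addr0 => /eqP; rewrite eq_sym oner_eq0.
Qed.

Lemma on_line u x y : u != 0 -> dot u y = dot u x ->
  y = x + (dot (perp u) (y - x) / dot u u) *: perp u.
Proof.
move=> u0 uxy; have uu := lt0r_neq0 (dot_gt0 _ u0).
have e : dot u (y - x) = 0 by move: uxy; rewrite !planeE; lra.
set k := _ / _.
have kE : k * dot u u = dot (perp u) (y - x) by rewrite divfK.
(* These multiples make the coordinate goals linear in the monomials. *)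
have e0 := congr1 ( *%R (u 0 0)) e; have e1 := congr1 ( *%R (u 0 1)) e.
have k0 := congr1 ( *%R (u 0 0)) kE; have k1 := congr1 ( *%R (u 0 1)) kE.
apply: plane_eq; apply: (mulIf uu); clearbody k.
- by move: e0 k1; rewrite !planeE; lra.
- by move: e1 k0; rewrite !planeE; lra.
Qed.

Lemma edist_eq x y x' y' : Defs.edist x y = Defs.edist x' y' ->
  dot (x - y) (x - y) = dot (x' - y') (x' - y').
Proof.
move=> e; rewrite -(sqr_sqrtr (dot_ge0 (x - y))) -/(Defs.edist x y) e.
by rewrite sqr_sqrtr// dot_ge0.
Qed.

Lemma edist_le x y r : 0 <= r ->
  (Defs.edist x y <= r) = (dot (x - y) (x - y) <= r ^+ 2).
Proof.
by move=> r0; rewrite -[RHS]ler_sqrt ?sqr_ge0// sqrtr_sqr ger0_norm.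
Qed.

(** * Existence of contact points *)

Lemma dot_continuous u : continuous (dot u).
Proof.
rewrite (_ : dot u = (fun x => u 0 0 * x 0 0 + u 0 1 * x 0 1)); last first.
  by apply/funext => x; rewrite dotE.
have c i y : u 0 i * x 0 i @[x --> y] --> u 0 i * y 0 i.
  by apply: cvgM; [exact: cvg_cst|exact: coord_continuous].
by move=> y; exact: (cvgD (c 0 y) (c 1 y)).
Qed.

Lemma contact_ex C u : compact C -> C !=set0 -> exists P, contact C u P.
Proof.
move=> cC C0.
have [|P PC maxP] := @compact_EVT_max _ _ (dot u) C C0 cC.
  exact/continuous_subspaceT/dot_continuous.
by exists P; split => [|x Cx]; [exact/set_mem|exact/maxP/mem_set].
Qed.

(** A short step along [u] from an interior point stays in [C] and increases [dot u], so interior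
    points are never maximal. *)
Lemma contact_not_constant C u P : interior C !=set0 -> u != 0 -> contact C u P ->
  exists2 x, C x & dot u x < dot u P.
Proof.
move=> [x Cx] u0 [_ maxP]; exists x; first exact: interior_subset.
have lim_x : (fun t => x + t *: u) t @[t --> 0] --> x.
  rewrite -[X in _ --> X]addr0; apply: cvgD; first exact: cvg_cst.
  by rewrite -[X in _ --> X](scale0r u); apply: cvgZr_tmp; exact: cvg_id.
have /nbhs_ballP[e /= e0 ballC] := lim_x _ Cx.
have := maxP (x + (e / 2) *: u) (ballC _ _).
rewrite /ball /= sub0r normrN gtr0_norm ?divr_gt0// gtr_pMr// invf_lt1// ltr1n.
by move=> /(_ isT); have := dot_gt0 _ u0; rewrite !planeE; nra.
Qed.

Lemma convex_combination C x y t : convex_set C -> C x -> C y ->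
  0 <= t -> t <= 1 -> C (t *: x + (1 - t) *: y).
Proof.
move=> cvxC Cx Cy t0 t1; apply/set_mem.
exact: (cvxC x y (Itv01 t0 t1) (mem_set Cx) (mem_set Cy)).
Qed.

Lemma contact_supporting C u P : contact C u P -> u != 0 ->
  supporting_line C [set x | dot u x = dot u P].
Proof. by move=> [CP maxP] u0; exists u, (dot u P); split => //; exists P. Qed.

(** * Consequences of isosceles caps *)

(** Recasts the hypothesis on caps in terms of normals and squared lengths. The lines differ because
    [S + perp u] lies only on the first. *)
Lemma isosceles_tangents C u v P Q S : (forall K : cap C, isosceles K) ->
  contact C u P -> contact C v Q -> dot (perp u) v != 0 ->
  dot u S = dot u P -> dot v S = dot v Q -> ~ C S ->
  dot (P - S) (P - S) = dot (S - Q) (S - Q).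
Proof.
move=> isoC uP vQ uv uS vS nCS.
have u0 : u != 0 by apply: contraNneq uv => ->; rewrite !planeE; apply/eqP; ring.
have v0 : v != 0 by apply: contraNneq uv => ->; rewrite !planeE; apply/eqP; ring.
apply: edist_eq.
have tangents : exists L M : set (plane R),
    [/\ supporting_line C L, supporting_line C M, L <> M,
        (L `&` M) S & (C `&` L) P /\ (C `&` M) Q].
  exists [set x | dot u x = dot u P], [set x | dot v x = dot v Q].
  split; [exact: contact_supporting|exact: contact_supporting| |by []|].
    move=> LM; have : [set x | dot v x = dot v Q] (S + perp u).
      by rewrite -LM /= -uS !planeE; ring.
    rewrite /= -vS => e; move/eqP: uv; apply.
    by move: e; rewrite !planeE; lra.
  by split; split=> //; [case: uP|case: vQ].
exact: (isoC (Cap nCS tangents)).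
Qed.

(** An apex [S] outside [C] on a line touching [C] at two distinct points would be equidistant from
    both, hence their midpoint, which convexity puts in [C]. *)
Lemma contact_unique C u P P' : convex_disc C ->
  (forall K : cap C, isosceles K) -> u != 0 ->
  contact C u P -> contact C u P' -> P = P'.
Proof.
move=> [cC cvxC C0] isoC u0 uP uP'.
have Cn0 : C !=set0 by case: C0 => x /interior_subset; exists x.
have uPP' : dot u P' = dot u P.
  by apply/eqP; rewrite eq_le (uP.2 _ uP'.1) (uP'.2 _ uP.1).
have [x0 Cx0 ux0] := contact_not_constant _ _ _ C0 u0 uP.
pose w := perp u; have [Z [CZ maxZ]] := contact_ex C w cC Cn0.
have uu := dot_gt0 _ u0.
(* The normal [v] is a slight tilt of [- u]. As [e * k < dot u P - dot u x0], [dot v] is larger at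
   [x0] than at any point of [C] on the given line, so the second tangent meets that line outside
   [C]. The [+ 1] covers [k = 0]. *)
pose k := dot w Z - dot w x0.
have k0 : 0 <= k by rewrite subr_ge0 maxZ.
pose e := (dot u P - dot u x0) / (k + 1).
have k1 : 0 < k + 1 by lra.
have e0 : 0 < e by rewrite divr_gt0// subr_gt0.
have ek : e * k < dot u P - dot u x0.
  have : e * (k + 1) = dot u P - dot u x0 by rewrite divfK// gt_eqF.
  by lra.
pose v := e *: w - u.
have [Q vQ] := contact_ex C v cC Cn0.
have wv : dot w v = e * dot u u by rewrite !planeE; ring.
have wv0 : dot w v != 0 by rewrite wv mulf_neq0 ?gt_eqF.
pose a := (dot v Q - dot v P) / dot w v.
pose S := P + a *: w.
have uS : dot u S = dot u P by rewrite !planeE; ring.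
have vS : dot v S = dot v Q.
  have -> : dot v S = dot v P + a * dot w v by rewrite !planeE; ring.
  by rewrite divfK//; ring.
have nCS : ~ C S.
  move=> CS; have := vQ.2 _ Cx0; have := maxZ _ CS; rewrite -vS.
  have vE x : dot v x = e * dot w x - dot u x by rewrite !planeE; ring.
  rewrite !vE uS => wS; move: ek; rewrite /k; nra.
have uS' : dot u S = dot u P' by rewrite uPP'.
have PSQ := isosceles_tangents _ _ _ _ _ _ isoC uP vQ wv0 uS vS nCS.
have PSQ' := isosceles_tangents _ _ _ _ _ _ isoC uP' vQ wv0 uS' vS nCS.
have P'E := on_line u P P' u0 uPP'.
set b := _ / _ in P'E.
(* Equal legs give [a ^+ 2 = (b - a) ^+ 2]; the root [b = 2 * a] is the midpoint case. *)
have /eqP : b * (b - 2 * a) = 0.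
  apply: (mulIf (lt0r_neq0 uu)); move: PSQ'; rewrite -PSQ P'E !planeE; lra.
rewrite mulf_eq0 => /orP[/eqP b0|/eqP b2a]; first by rewrite P'E b0 scale0r addr0.
case: nCS; rewrite (_ : S = 2^-1 *: P + (1 - 2^-1) *: P').
  by apply: convex_combination => //; [exact: uP.1|exact: uP'.1|lra].
by rewrite P'E /S (_ : b = 2 * a); [apply: plane_eq; rewrite !planeE; lra|lra].
Qed.

(* [P - Q] is orthogonal to the bisector direction [u + v]: the two legs of the
   cap are rotated normals with equal and opposite coefficients. *)
Lemma contact_mirror C u v P Q : convex_disc C ->
  (forall K : cap C, isosceles K) -> dot u u = 1 -> dot v v = 1 ->
  contact C u P -> contact C v Q -> dot (P - Q) (u + v) = 0.
Proof.
move=> discC isoC uu vv uP vQ.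
have u0 := unit_neq0 _ uu; have v0 := unit_neq0 _ vv.
(* Parallel unit normals form no cap: they are opposite, so [u + v = 0], or equal, so [P] and [Q]
   attain the same maximum. *)
have [uv|uv] := eqVneq (dot (perp u) v) 0.
  have /eqP : dot (u - v) (u - v) * dot (u + v) (u + v) = 0.
    suff -> : dot (u - v) (u - v) * dot (u + v) (u + v) =
      (dot u u - dot v v) ^+ 2 + 4 * dot (perp u) v ^+ 2.
      by rewrite uv uu vv; ring.
    by rewrite !planeE; ring.
  rewrite mulf_eq0 => /orP[] /eqP e; last first.
    have /eqP -> : u + v == 0 by apply: contra_eqT e => /dot_gt0/lt0r_neq0.
    by rewrite !planeE; ring.
  have /eqP : u - v == 0 by apply: contra_eqT e => /dot_gt0/lt0r_neq0.
  move/subr0_eq => e'; rewrite -e' in vQ *.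
  have := uP.2 _ vQ.1; have := vQ.2 _ uP.1; rewrite !planeE; lra.
pose a := (dot v Q - dot v P) / dot (perp u) v.
pose S := P + a *: perp u.
have uS : dot u S = dot u P by rewrite !planeE; ring.
have vS : dot v S = dot v Q.
  have -> : dot v S = dot v P + a * dot (perp u) v by rewrite !planeE; ring.
  by rewrite divfK//; ring.
(* An apex in [C] is a contact point for both normals, so uniqueness gives [P = S = Q]. *)
have [CS|nCS] := pselect (C S).
  have uS' : contact C u S by split=> // x /uP.2; rewrite uS.
  have vS' : contact C v S by split=> // x /vQ.2; rewrite vS.
  rewrite (contact_unique _ _ _ _ discC isoC u0 uP uS').
  rewrite (contact_unique _ _ _ _ discC isoC v0 vQ vS').
  by rewrite !planeE; ring.
have PSQ := isosceles_tangents _ _ _ _ _ _ isoC uP vQ uv uS vS nCS.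
have QE := on_line v S Q v0 (esym vS).
set b := _ / _ in QE.
have PE : P = S - a *: perp u by rewrite addrK.
have ab : a ^+ 2 = b ^+ 2.
  have : a ^+ 2 * dot u u = b ^+ 2 * dot v v.
    by move: PSQ; rewrite QE {1 2}PE !planeE; lra.
  by rewrite uu vv !mulr1.
(* Maximality of [Q] and [P] prevents [a] and [b] from having opposite signs, so [a = - b] only if
   both vanish. *)
have ak : 0 <= a * dot (perp u) v.
  by rewrite divfK// subr_ge0; exact: vQ.2 uP.1.
have bk : 0 <= b * dot (perp u) v.
  by have := uP.2 _ vQ.1; rewrite -uS {1}QE !planeE; lra.
have {ab} /eqP : (a - b) * (a + b) = 0 by lra.
rewrite mulf_eq0 => /orP[] /eqP e.
  rewrite (_ : dot _ _ = (b - a) * dot (perp u) v); first by rewrite -opprB e; ring.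
  by rewrite QE {1}PE !planeE; ring.
have /eqP : a * dot (perp u) v = 0.
  rewrite (_ : b = - a) in bk; lra.
rewrite mulf_eq0 (negbTE uv) orbF => /eqP a0.
have b0 : b = 0 by lra.
by rewrite QE {1}PE a0 b0 !planeE; ring.
Qed.

(** * From mirror symmetry to the disc *)

Lemma contact_circle C : convex_disc C -> (forall K : cap C, isosceles K) ->
  exists c r, forall u P, dot u u = 1 -> contact C u P -> P = c + r *: u.
Proof.
move=> discC isoC; have [cC _ [x0 /interior_subset Cx0]] := discC.
have ex u : exists P, contact C u P by apply: contact_ex => //; exists x0.
have mirror := contact_mirror _ _ _ _ _ discC isoC.
have unit1 : dot (point 1 0) (point 1 0) = 1 by rewrite !planeE; ring.
have unit2 : dot (point 0 1) (point 0 1) = 1 by rewrite !planeE; ring.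
have unit3 : dot (point (- 1) 0) (point (- 1) 0) = 1 by rewrite !planeE; ring.
have unit4 : dot (point 0 (- 1)) (point 0 (- 1)) = 1 by rewrite !planeE; ring.
(* Two orthogonal directions leave [M] with equal diagonal entries and equal
   off-diagonal entries; a rational direction off the axes kills the latter. *)
have unit5 : dot (point (3 / 5) (4 / 5)) (point (3 / 5) (4 / 5)) = 1.
  by rewrite !planeE; lra.
have [A1 eA1] := ex (point 1 0); have [A2 eA2] := ex (point 0 1).
have [A3 eA3] := ex (point (- 1) 0); have [A4 eA4] := ex (point 0 (- 1)).
have [D eD] := ex (point (3 / 5) (4 / 5)).
(* Centre and half the width of the bounding box of [C]. *)
pose c0 := (A1 0 0 + A3 0 0) / 2; pose c1 := (A2 0 1 + A4 0 1) / 2.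
pose r := (A1 0 0 - A3 0 0) / 2.
have : [/\ A1 = point (c0 + r) c1, A2 = point c0 (c1 + r),
    A3 = point (c0 - r) c1 & A4 = point c0 (c1 - r)].
  move: (mirror _ _ _ _ unit1 unit2 eA1 eA2) (mirror _ _ _ _ unit1 unit4 eA1 eA4)
    (mirror _ _ _ _ unit3 unit2 eA3 eA2) (mirror _ _ _ _ unit3 unit4 eA3 eA4)
    (mirror _ _ _ _ unit5 unit1 eD eA1) (mirror _ _ _ _ unit5 unit2 eD eA2)
    (mirror _ _ _ _ unit5 unit3 eD eA3) (mirror _ _ _ _ unit5 unit4 eD eA4).
  rewrite !planeE /c0 /c1 /r => *.
  by split; apply: plane_eq; rewrite !planeE; lra.
case=> A1E A2E A3E A4E; exists (point c0 c1), r => u P uu uP.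
(* Subtracting the equations for opposite axis directions cancels [dot P u] and isolates one
   coordinate of [P]. *)
move: (mirror _ _ _ _ uu unit1 uP eA1) (mirror _ _ _ _ uu unit2 uP eA2)
  (mirror _ _ _ _ uu unit3 uP eA3) (mirror _ _ _ _ uu unit4 uP eA4).
rewrite A1E A2E A3E A4E; clearbody c0 c1 r; rewrite !planeE => *.
by apply: plane_eq; rewrite !planeE; lra.
Qed.

Lemma polar x y : exists2 u, dot u u = 1 & x - y = Defs.edist x y *: u.
Proof.
have [xy|xy] := eqVneq (x - y) 0.
  exists (point 1 0); first by rewrite !planeE; ring.
  by rewrite /Defs.edist xy (_ : dot 0 0 = 0) ?sqrtr0 ?scale0r// !planeE; ring.
have d0 : Defs.edist x y != 0 by rewrite sqrtr_eq0 -ltNge dot_gt0.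
exists ((Defs.edist x y)^-1 *: (x - y)); last by rewrite scalerA mulfV// scale1r.
have -> : forall t z, dot (t *: z) (t *: z) = t ^+ 2 * dot z z.
  by move=> t z; rewrite !planeE; ring.
by rewrite -[dot _ _]sqr_sqrtr ?dot_ge0// -exprMn mulVf// expr1n.
Qed.

Lemma isosceles_circular C : convex_disc C ->
  (forall K : cap C, isosceles K) -> circular_disc C.
Proof.
move=> discC isoC; have [cC cvxC C0] := discC.
have [c [r circle]] := contact_circle _ discC isoC.
have ex u : exists P, contact C u P.
  by apply: contact_ex => //; case: C0 => x /interior_subset; exists x.
have sphere u : dot u u = 1 -> contact C u (c + r *: u).
  by move=> uu; have [P uP] := ex u; rewrite -(circle u P).
have sphereN u : dot u u = 1 -> contact C (- u) (c - r *: u).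
  move=> uu; rewrite -scalerN; apply: sphere; rewrite -uu !planeE; ring.
(* The width of [C] along the first axis is [2 * r], and nonempty interior makes it positive. *)
have r0 : 0 < r.
  have e11 : dot (point 1 0) (point 1 0) = 1 by rewrite !planeE; ring.
  have [x Cx] := contact_not_constant _ _ _ C0 (unit_neq0 _ e11) (sphere _ e11).
  by have := (sphereN _ e11).2 _ Cx; rewrite !planeE; lra.
exists c, r; split => //; apply/seteqP; split => x /=.
  have [u uu xE] := polar x c; move=> /(sphere u uu).2.
  have -> : dot u x = dot u c + Defs.edist x c * dot u u.
    by rewrite -[in LHS](subrK c x) xE !planeE; ring.
  have -> : dot u (c + r *: u) = dot u c + r * dot u u by rewrite !planeE; ring.
  by rewrite uu; lra.
move=> xr; have [u uu xE] := polar x c; set s := Defs.edist x c in xr xE.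
have s0 : 0 <= s by exact: sqrtr_ge0.
have sr0 : 0 <= s / r by rewrite divr_ge0// ltW.
have sr1 : s / r <= 1 by rewrite ler_pdivrMr// mul1r.
(* The point [c + s *: u] divides the diameter along [u], whose ends lie in [C]. *)
have -> : x = ((1 + s / r) / 2) *: (c + r *: u) +
    (1 - (1 + s / r) / 2) *: (c - r *: u).
  rewrite -[LHS](subrK c x) xE; have r1 := lt0r_neq0 r0.
  by apply: plane_eq; rewrite !planeE; field.
by apply: convex_combination => //;
  [exact: (sphere u uu).1|exact: (sphereN u uu).1|lra|lra].
Qed.

(** * Tangent lengths of a circular disc *)

(** Pythagoras: the radius to [P] points along [u], so the squared tangent length is the power of
    [S], independent of [P]. *)
Lemma circle_contact c r u P S : 0 < r -> u != 0 ->
  contact [set x | Defs.edist x c <= r] u P -> dot u S = dot u P ->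
  dot (P - S) (P - S) = dot (S - c) (S - c) - r ^+ 2.
Proof.
move=> r0 u0 [/= Pc maxP] uS; have uu := dot_gt0 _ u0.
pose s := Num.sqrt (dot u u).
have s2 : s ^+ 2 = dot u u by rewrite sqr_sqrtr// dot_ge0.
have s0 : 0 < s by rewrite sqrtr_gt0.
have rs : r / s * dot u u = r * s by rewrite -s2; field; exact: lt0r_neq0.
move: Pc; rewrite (edist_le _ _ _ (ltW r0)) => Pc.
(* Compare [P] with the boundary point of the disc in direction [u]. *)
have uPc : r * s <= dot u (P - c).
  have /maxP : [set x | Defs.edist x c <= r] (c + (r / s) *: u).
    rewrite /= (edist_le _ _ _ (ltW r0)) (_ : dot _ _ = r / s * (r / s * dot u u)).
      by rewrite rs (_ : r / s * _ = r ^+ 2)//; field; exact: lt0r_neq0.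
    by rewrite !planeE; ring.
  have -> : dot u (c + (r / s) *: u) = dot u c + r / s * dot u u.
    by rewrite !planeE; ring.
  by rewrite rs !planeE; lra.
(* Equality case of Cauchy-Schwarz: the difference has nonpositive squared norm. *)
have PcE : s *: (P - c) = r *: u.
  apply/eqP; rewrite -subr_eq0; apply: contraTT isT => /dot_gt0.
  have -> : dot (s *: (P - c) - r *: u) (s *: (P - c) - r *: u) =
      s ^+ 2 * dot (P - c) (P - c) - 2 * r * s * dot u (P - c) + r ^+ 2 * dot u u.
    by rewrite !planeE; ring.
  rewrite -s2 ltNge => /negP[].
  have : s ^+ 2 * dot (P - c) (P - c) <= s ^+ 2 * r ^+ 2 by rewrite ler_wpM2l// sqr_ge0.
  have : (r * s) * (r * s) <= (r * s) * dot u (P - c).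
    by rewrite ler_wpM2l// mulr_ge0// ltW.
  lra.
have {}PcE : P - c = (r / s) *: u.
  by rewrite mulrC -scalerA -PcE scalerA mulVf ?scale1r// lt0r_neq0.
have -> : S - c = (S - P) + (r / s) *: u by rewrite -PcE addrA subrK.
have -> : dot (S - P + (r / s) *: u) (S - P + (r / s) *: u) =
  dot (P - S) (P - S) + 2 * (r / s) * (dot u S - dot u P) + r / s * (r / s * dot u u).
  by rewrite !planeE; ring.
by rewrite uS rs; field; exact: lt0r_neq0.
Qed.

(** Both squared legs equal the power of the apex. *)
Lemma circular_isosceles C (K : cap C) : circular_disc C -> isosceles K.
Proof.
move=> [c [r [r0 CE]]].
suff tangent L P S : supporting_line C L -> (C `&` L) P -> L S ->
    dot (P - S) (P - S) = dot (S - c) (S - c) - r ^+ 2.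
  case: K => S P Q nCS [L [M [CL CM LM [LS MS] [CP CQ]]]].
  have SQ : dot (S - Q) (S - Q) = dot (Q - S) (Q - S) by rewrite !planeE; ring.
  by rewrite /isosceles /Defs.edist /= SQ (tangent L P S)// (tangent M Q S).
move=> [u [a [u0 -> Ca _]]] [CP /= uP] /= uS; apply: (circle_contact _ _ u) => //.
  by rewrite -CE; split => // x /Ca; rewrite uP.
by rewrite uS.
Qed.

End Plane.

Theorem theorem3 (R : realType) (C : set (plane R)) (hC : convex_disc C) :
  (forall K : cap C, isosceles K) <-> circular_disc C.
Proof.
by split => [|circC K]; [exact: isosceles_circular|exact: circular_isosceles].
Qed.
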